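(* There is an absolute constant $C>0$ such that every graph $G=(V,E)$ with $n=|V|\ge 2$ vertices and maximum degree $\Delta$ satisfies $$\mathcal{R}(G)\;\ge\; C\cdot\frac{\sqrt{n}}{\Delta}\cdot\sqrt{\log n}.$$
   Context: Graphs are finite, undirected, simple and connected. A random walk on $G$ moves at each step from its current vertex to a neighbor chosen uniformly at random. The cover time $\mathsf{COV}(s)$ is the expected number of steps for the walk started at $s$ to visit all vertices, and $\mathsf{COV}(G)=\max_{s\in V}\mathsf{COV}(s)$. Randomized broadcast algorithm $\mathsf{RBA}$ (push algorithm): at time $0$ only a vertex $s$ knows a rumor; at each time step $t=1,2,\dots$ every vertex that knows the rumor chooses, independently, a neighbor uniformly at random and informs it. $I_t$ is the set of informed vertices at time $t$ ($I_0=\{s\}$). The expected broadcast time is $\mathbf{E}[\mathsf{RBA}(G)]:=\max_{s\in V}\mathbf{E}[\min\{t: I_t=V\}\text{ with } I_0=\{s\}]$. Finally $\mathcal{R}(G):=\mathsf{COV}(G)/\mathbf{E}[\mathsf{RBA}(G)]$. *)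

(* Defs.v *)
From mathcomp Require Import all_boot all_order all_algebra.
From mathcomp Require Import reals ereal sequences exp.

Set Implicit Arguments.
Unset Strict Implicit.
Unset Printing Implicit Defensive.

Import Order.TTheory GRing.Theory Num.Theory.
Local Open Scope ring_scope.

(* Stopping times of a finite Markov chain X with transition probabilities
   [K x y], computed from the law of its finite trajectories.  A stopping rule
   [stop] reads the whole history X_0 :: ... :: X_t, and the associated time is
     T = min {t | stop (X_0 :: ... :: X_t)}   (T = +oo if there is no such t). *)
Section StoppingTime.
Variables (R : realType) (S : finType) (K : S -> S -> R) (stop : pred (seq S)).

(* P(X_1 = w_1, ..., X_t = w_t | X_0 = x) for w = [:: w_1; ...; w_t] *)
Fixpoint path_prob (x : S) (w : seq S) : R :=
  if w is y :: w' then K x y * path_prob y w' else 1.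

Definition stops_at (x : S) (t : nat) (w : seq S) : bool :=
  stop (x :: take t w) && [forall i : 'I_t, ~~ stop (x :: take i w)].

(* P(T = t | X_0 = x) *)
Definition stop_prob (x : S) (t : nat) : R :=
  \sum_(w : t.-tuple S | stops_at x t w) path_prob x w.

(* E[T | X_0 = x] as the sum over t in {0, 1, ..., +oo} of t * P(T = t).  The
   last summand is +oo * P(T = +oo), which is 0 when T is almost surely finite
   since +oo * 0 = 0 in \bar R. *)
Definition expected_stop (x : S) : \bar R :=
  (\sum_(0 <= t <oo) (t%:R * stop_prob x t)%:E
   + +oo * (1 - \sum_(0 <= t <oo) (stop_prob x t)%:E))%E.

End StoppingTime.

(* A graph on the vertex set V is given by its adjacency relation e. *)
Section Graph.
Variables (R : realType) (V : finType) (e : rel V).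

Definition deg (v : V) : nat := #|[set u | e v u]|.

Definition max_deg : nat := \max_(v : V) deg v.

(* The law of a uniformly random neighbor of v. *)
Definition nbr_prob (v u : V) : R := if e v u then (deg v)%:R^-1 else 0.

Definition all_visited (w : seq V) : bool := [forall v, v \in w].

Definition COVs (s : V) : \bar R := expected_stop nbr_prob all_visited s.

Definition COV : \bar R := \big[maxe/-oo%E]_(s : V) COVs s.

(* One round of the push algorithm when A is the set of informed vertices: c is
   the tuple of the independent choices made by the members of A (and by them
   only), and the informed set becomes A together with the chosen vertices. *)
Definition push_prob (A B : {set V}) : R :=
  \sum_(c : {ffun {v : V | v \in A} -> V}
          | A :|: [set c v | v : {v : V | v \in A}] == B)
    \prod_(v : {v : V | v \in A}) nbr_prob (val v) (c v).

Definition all_informed (w : seq {set V}) : bool := last set0 w == setT.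

Definition RBAs (s : V) : \bar R := expected_stop push_prob all_informed [set s].

Definition RBA : \bar R := \big[maxe/-oo%E]_(s : V) RBAs s.

(* On a connected graph COV and RBA are finite, so [fine] loses nothing there
   (beware that [fine] maps infinite values to 0). *)
Definition cov_rba_ratio : R := fine COV / fine RBA.

End Graph.

(* Main.v *)
Require Import Defs.
From mathcomp Require Import classical_sets.
From mathcomp Require Import all_boot all_order all_algebra.
From mathcomp Require Import boolp reals ereal topology normedtype sequences exp.
From mathcomp Require Import ring lra.
Import Order.TTheory GRing.Theory Num.Theory.
Import numFieldNormedType.Exports.
Local Open Scope ring_scope.

Set Implicit Arguments.
Unset Strict Implicit.
Unset Printing Implicit Defensive.

(* Let D be the diameter.  The proof combines three estimates, with n log n and
   D^2 balanced by the AM-GM inequality: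
     E[RBA] <= 2 Delta (1 + log n + D),  COV >= D^2,  COV >= n log n / 24.
   Expected stopping times are compared with sub- and supersolutions of their
   one-step equations.  For RBA the supersolution is 2 Delta (1 + log Psi(A)) with
   Psi(A) = sum_v (2^dist(A,v) - 1), since one round multiplies Psi by at most
   1 - 1/(2 Delta) in expectation.  For COV the estimates rest on hitting times
   H(u,v): u |-> H(u,v) - H(u,w) is a potential for a current between v and w, so
   Cauchy-Schwarz for the Dirichlet form gives H(u,v) + H(v,u) >= 2 dist(u,v)^2
   and H(u,v) + H(v,u) >= vol / deg v; moreover H(u,v) - H(v,u) is of the form
   kappa(v) - kappa(u).  With Matthews' method this yields the n log n bound as
   in Feige's theorem. *)

(** * Expected stopping times *)

Lemma sum_tuple_rcons (R : nmodType) (S : finType) (t : nat) (P : pred (seq S))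
    (F : seq S -> R) :
  \sum_(w : t.+1.-tuple S | P w) F w =
  \sum_(w : t.-tuple S) \sum_(y | P (rcons w y)) F (rcons w y).
Proof.
rewrite (pair_big_dep xpredT (fun (w : t.-tuple S) y => P (rcons w y))
  (fun w y => F (rcons w y))) /=.
pose f (wy : t.-tuple S * S) : t.+1.-tuple S := [tuple of rcons wy.1 wy.2].
pose g (u : t.+1.-tuple S) : t.-tuple S * S :=
  ([tuple of belast (thead u) (behead u)], last (thead u) (behead u)).
rewrite (reindex f) //=; apply: onW_bij; exists g => [[w y]|u].
  rewrite /g /f; congr (_, _) => /=; last first.
    case: w => [[|a w] Hw] //=; rewrite /thead (tnth_nth y) //=.
    by rewrite last_rcons.
  apply: val_inj => /=; case: w => [[|a w] Hw] //=.
  by rewrite /thead (tnth_nth y) /= belast_rcons.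
apply: val_inj => /=; case: u => [[|a w] Hw] //=.
by rewrite /thead (tnth_nth a) /= -lastI.
Qed.

Section StoppingBounds.
Variables (R : realType) (S : finType) (K : S -> S -> R) (stop : pred (seq S)).
Variable x : S.
Hypothesis K_ge0 : forall a b, 0 <= K a b.
Hypothesis K_sum1 : forall a, \sum_b K a b = 1.

Local Notation pp := (path_prob K).

Definition running (t : nat) (w : seq S) : bool :=
  [forall i : 'I_t.+1, ~~ stop (x :: take i w)].

(** This is E[G(X_1, ..., X_t); T > t]. With G = 1, written [q] below, it is the survival
    probability P(T > t). *)
Definition run_sum (G : seq S -> R) (t : nat) : R :=
  \sum_(w : t.-tuple S | running t w) pp x w * G w.

Lemma path_prob_ge0 a w : 0 <= pp a w.
Proof. by elim: w a => //= y w IH a; rewrite mulr_ge0. Qed.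

Lemma path_prob_rcons a w y : pp a (rcons w y) = pp a w * K (last a w) y.
Proof.
by elim: w a => /= [|z w IH] a; rewrite ?mulr1 ?mul1r // IH mulrA.
Qed.

Lemma running_stopN t (w : t.-tuple S) : running t w -> ~~ stop (x :: w).
Proof. by move=> /forallP/(_ ord_max) /=; rewrite take_oversize ?size_tuple. Qed.

Lemma forall_prefix_rcons t (w : t.-tuple S) y :
  [forall i : 'I_t.+1, ~~ stop (x :: take i (rcons w y))] = running t w.
Proof.
apply: eq_forallb => i; congr (~~ stop (x :: _)).
by rewrite -cats1 takel_cat // size_tuple -ltnS.
Qed.

Lemma stops_at_rcons t (w : t.-tuple S) y :
  stops_at stop x t.+1 (rcons w y) = stop (x :: rcons w y) && running t w.
Proof.
by rewrite /stops_at take_oversize ?size_rcons ?size_tuple // forall_prefix_rcons.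
Qed.

Lemma running_rcons t (w : t.-tuple S) y :
  running t.+1 (rcons w y) = ~~ stop (x :: rcons w y) && running t w.
Proof.
rewrite -(forall_prefix_rcons w y) /running; apply/forallP/andP => [H|[H1 H2] i].
  split; first by have /= := H ord_max; rewrite take_oversize ?size_rcons ?size_tuple.
  by apply/forallP => i; have := H (widen_ord (leqnSn _) i).
have [i_lt|] := ltnP i t.+1; first exact: (forallP H2 (Ordinal i_lt)).
by move=> le_i; rewrite take_oversize ?size_rcons ?size_tuple.
Qed.

(** On T > t, the next step either keeps running or stops exactly at t + 1, and these two cases
    split the conditional expectation of [G]. *)
Lemma run_sum_step (G : seq S -> R) t :
  \sum_(w : t.-tuple S | running t w)
     pp x w * (\sum_y K (last x w) y * G (rcons w y)) =
  run_sum G t.+1 +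
  \sum_(w : t.+1.-tuple S | stops_at stop x t.+1 w) pp x w * G w.
Proof.
rewrite /run_sum (sum_tuple_rcons t (running t.+1) (fun w => pp x w * G w)).
rewrite (sum_tuple_rcons t (stops_at stop x t.+1) (fun w => pp x w * G w)) -big_split /=.
rewrite big_mkcond; apply: eq_bigr => w _.
under [X in _ = X + _]eq_bigl => y do rewrite running_rcons.
under [X in _ = _ + X]eq_bigl => y do rewrite stops_at_rcons.
case: (running t w); last by rewrite !big_pred0 ?addr0 // => y; rewrite andbF.
under [X in _ = _ + X]eq_bigl => y do rewrite andbT.
under [X in _ = X + _]eq_bigl => y do rewrite andbT.
rewrite addrC -(bigID (fun y => stop (x :: rcons w y)) xpredT) /= mulr_sumr.
by apply: eq_bigr => y _; rewrite path_prob_rcons mulrA.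
Qed.

Local Notation q := (run_sum (fun=> 1)).
Local Notation p := (stop_prob K stop x).

Lemma stop_prob_ge0 t : 0 <= p t.
Proof. by apply: sumr_ge0 => w _; exact: path_prob_ge0. Qed.

Lemma run_sum_ge0 (G : seq S -> R) t : (forall w, 0 <= G w) -> 0 <= run_sum G t.
Proof. by move=> G0; apply: sumr_ge0 => w _; rewrite mulr_ge0 ?path_prob_ge0. Qed.

Lemma survival_ge0 t : 0 <= q t.
Proof. exact: run_sum_ge0. Qed.

Lemma survival_step t : q t = q t.+1 + p t.+1.
Proof.
have <- : \sum_(w : t.-tuple S | running t w)
    pp x w * (\sum_y K (last x w) y * 1) = q t.
  by apply: eq_bigr => w _; rewrite -mulr_suml K_sum1 mul1r.
rewrite (run_sum_step (fun=> 1)); congr (_ + _).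
by apply: eq_bigr => w _; rewrite mulr1.
Qed.

Lemma sum_tuple0 (P : pred (seq S)) (F : seq S -> R) :
  \sum_(w : 0.-tuple S | P w) F w = if P [::] then F [::] else 0.
Proof.
rewrite big_mkcond (big_pred1 [tuple]) //= => w.
by rewrite (tuple0 w) [RHS]eqxx.
Qed.

Lemma run_sum0 (G : seq S -> R) :
  run_sum G 0 = if stop [:: x] then 0 else G [::].
Proof.
rewrite /run_sum (sum_tuple0 (running 0) (fun w => pp x w * G w)) /= mul1r.
rewrite /running; case: forallP => [/(_ ord0)/negbTE -> //|].
by case: (boolP (stop [:: x])) => // nst []  [i Hi] /=.
Qed.

Lemma survival0 : p 0 + q 0 = 1.
Proof.
rewrite run_sum0 /stop_prob (sum_tuple0 (stops_at stop x 0)) /= /stops_at /=.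
have -> : [forall i : 'I_0, ~~ stop [:: x]] by apply/forallP => -[].
by rewrite andbT; case: ifP; rewrite ?addr0 ?add0r.
Qed.

Lemma sum_stop_prob t : \sum_(0 <= i < t.+1) p i = 1 - q t.
Proof.
elim: t => [|t IH]; first by rewrite big_nat1; apply: (canRL (addrK _)); exact: survival0.
by rewrite big_nat_recr //= IH [q t]survival_step; ring.
Qed.

(** Summation by parts, expressing E[T; T <= t] through the tails P(T > i). *)
Lemma sum_time_prob t :
  \sum_(0 <= i < t.+1) i%:R * p i = \sum_(0 <= i < t) q i - t%:R * q t.
Proof.
elim: t => [|t IH]; first by rewrite big_nat1 big_geq // !mul0r subr0.
rewrite big_nat_recr //= IH big_nat_recr //= [X in _ = _ + X - _]survival_step.
by rewrite [q t]survival_step -natr1; ring.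
Qed.

Lemma survival_nincr : {homo q : n m / (n <= m)%N >-> n >= m}.
Proof.
apply/nonincreasing_seqP => n; rewrite [q n]survival_step lerDl.
exact: stop_prob_ge0.
Qed.

(** The mean of [G] drops by at least 1 on each running step, and the stopped mass, being
    nonnegative, may be discarded. Only histories of positive probability are constrained, so the
    push algorithm may use that its source stays informed. *)
Lemma sum_survival_le (G : seq S -> R) :
  (forall w, 0 <= G w) ->
  (forall w, pp x w != 0 -> ~~ stop (x :: w) ->
     1 + \sum_y K (last x w) y * G (rcons w y) <= G w) ->
  forall t, \sum_(0 <= i < t) q i + run_sum G t <= G [::].
Proof.
move=> G0 HG; elim=> [|t IH].
  by rewrite big_geq // add0r run_sum0; case: ifP.
apply: le_trans IH; rewrite big_nat_recr //= -addrA lerD2l.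
rewrite -[X in q t + X]addr0 -lerBrDl; apply: le_trans (_ : _ <= run_sum G t - q t) _ => //.
rewrite lerBrDl.
have H0 : 0 <= \sum_(w : t.+1.-tuple S | stops_at stop x t.+1 w) pp x w * G w.
  by apply: sumr_ge0 => w _; rewrite mulr_ge0 ?path_prob_ge0.
apply: (@le_trans _ _ (q t + \sum_(w : t.-tuple S | running t w)
     pp x w * (\sum_y K (last x w) y * G (rcons w y)))).
  by rewrite lerD2l run_sum_step lerD2l.
rewrite /run_sum -big_split /=; apply: ler_sum => w rw; rewrite -mulrDr.
have [->|nz] := eqVneq (pp x w) 0; first by rewrite !mul0r.
by rewrite ler_wpM2l ?path_prob_ge0 ?HG // running_stopN.
Qed.

(** The dual bound: a subsolution is nonpositive where the process stops, so discarding the stopped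
    mass only raises the right-hand side. *)
Lemma le_sum_survival (F : seq S -> R) :
  (forall w, stop (x :: w) -> F w <= 0) ->
  (forall w, ~~ stop (x :: w) ->
     F w <= 1 + \sum_y K (last x w) y * F (rcons w y)) ->
  forall t, F [::] <= \sum_(0 <= i < t) q i + run_sum F t.
Proof.
move=> F0 HF; elim=> [|t IH].
  by rewrite big_geq // add0r run_sum0; case: ifP => // /F0.
apply: (le_trans IH); rewrite big_nat_recr //= -addrA lerD2l.
have H0 : \sum_(w : t.+1.-tuple S | stops_at stop x t.+1 w) pp x w * F w <= 0.
  apply: sumr_le0 => w /andP[]; rewrite take_oversize ?size_tuple // => sw _.
  by rewrite mulr_ge0_le0 ?path_prob_ge0 ?F0.
apply: (@le_trans _ _ (q t + \sum_(w : t.-tuple S | running t w)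
     pp x w * (\sum_y K (last x w) y * F (rcons w y)))).
  rewrite /run_sum -big_split /=; apply: ler_sum => w rw; rewrite -mulrDr.
  by rewrite ler_wpM2l ?path_prob_ge0 ?HF // running_stopN.
by rewrite lerD2l run_sum_step gerDl.
Qed.

Section Finite.
Variable M : R.
Hypothesis M_bound : forall t, \sum_(0 <= i < t) q i <= M.

(** As [q] is nonincreasing, (t + 1) q(t) <= q(0) + ... + q(t) <= M. *)
Lemma survival_cvg0 : (q @ \oo --> 0)%classic.
Proof.
have M0 : 0 <= M by have := M_bound 0; rewrite big_geq.
apply: (@squeeze_cvgr _ _ _ _ (fun=> 0) (fun t => M * harmonic t)).
- near=> t; rewrite survival_ge0 /= ler_pdivlMr ?ltr0n //.
  apply: le_trans (M_bound t.+1).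
  rewrite mulr_natr -[X in _ *+ X](subn0 t.+1) -sumr_const_nat.
  rewrite big_nat [X in _ <= X]big_nat; apply: ler_sum => i /andP[_ it].
  exact: survival_nincr.
- exact: cvg_cst.
- by rewrite -[X in (_ --> X)%classic](mulr0 M); apply: cvgMr; exact: cvg_harmonic.
Unshelve. all: by end_near. Qed.

(** Both sides are sums of the nonnegative terms [q i - q N], over i < t and over i < N. For fixed
    [t] the error [t%:R * q N] vanishes as N grows. *)
Lemma sum_survival_le_time t N : (t <= N)%N ->
  \sum_(0 <= i < t) q i - t%:R * q N <= \sum_(0 <= i < N.+1) i%:R * p i.
Proof.
move=> tN; rewrite sum_time_prob.
have E n : \sum_(0 <= i < n) q i - n%:R * q N = \sum_(0 <= i < n) (q i - q N).
  by rewrite sumrB sumr_const_nat subn0 mulr_natl.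
rewrite !E [leRHS](big_cat_nat (n := t)) //= lerDl big_nat; apply: sumr_ge0 => i /andP[_ iN].
by rewrite subr_ge0 survival_nincr // ltnW.
Qed.

Lemma expected_stop_real : exists r : R,
  [/\ expected_stop K stop x = r%:E, r <= M &
      forall t, \sum_(0 <= i < t) q i <= r].
Proof.
pose u := [series t%:R * p t]_t.
have u_nd : {homo u : n m / (n <= m)%N >-> n <= m}.
  apply/nondecreasing_seqP => n; rewrite /u /series /= big_nat_recr //= lerDl.
  by rewrite mulr_ge0 ?stop_prob_ge0.
have u_M n : u n <= M.
  apply: (@le_trans _ _ (u n.+1)); first exact: u_nd.
  rewrite /u /series /= sum_time_prob; apply: le_trans (M_bound n).
  by rewrite gerBl mulr_ge0 ?survival_ge0.
have u_cvg : cvgn u.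
  by apply: nondecreasing_is_cvgn => //; exists M => _ [n _ <-].
exists (limn u); split.
(* The stopping probabilities sum to 1, so the summand at infinity is +oo * 0 = 0. *)
- rewrite /expected_stop.
  have -> : (\sum_(0 <= t <oo) (p t)%:E = 1)%E.
    apply/cvg_lim => //; rewrite -cvg_shiftS /=.
    have -> : (fun n => \sum_(0 <= i < n.+1) (p i)%:E)%E = EFin \o (fun n => 1 - q n).
      by apply: funext => n; rewrite sumEFin sum_stop_prob.
    apply: cvg_EFin; first by near=> n.
    rewrite -[X in (_ --> X)%classic](subr0 1); apply: cvgB; first exact: cvg_cst.
    exact: survival_cvg0.
  rewrite subee // mule0 adde0 -EFin_lim //; congr (limn _).
  by apply: funext => n; rewrite sumEFin.
- by apply: limr_le => //; near=> n.
- move=> t.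
  have c : ((\sum_(0 <= i < t) q i - t%:R * q N) @[N --> \oo] --> \sum_(0 <= i < t) q i)%classic.
    rewrite -[X in (_ --> X)%classic]subr0; apply: cvgB; first exact: cvg_cst.
    by rewrite -[X in (_ --> X)%classic](mulr0 (t%:R)); apply: cvgMr; exact: survival_cvg0.
  have u_cvg1 : (u N.+1 @[N --> \oo] --> limn u)%classic.
    by rewrite (cvg_shiftS u).
  apply: (ler_cvg_to c u_cvg1); near=> N.
  by rewrite /u /series /=; apply: sum_survival_le_time; near: N; exact: nbhs_infty_ge.
Unshelve. all: by end_near. Qed.
End Finite.

(** The supersolution [G] makes the expectation a real [r]. For a subsolution bounded by [M] the
    leftover term is at most M q(t), which tends to 0. Quantifying over [F] after [r] lets one value
    serve several lower bounds. *)
Lemma expected_stop_bounds (G : seq S -> R) :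
  (forall w, 0 <= G w) ->
  (forall w, pp x w != 0 -> ~~ stop (x :: w) ->
     1 + \sum_y K (last x w) y * G (rcons w y) <= G w) ->
  exists r : R, [/\ expected_stop K stop x = r%:E, r <= G [::] &
    forall (F : seq S -> R) (M : R),
      (forall w, F w <= M) ->
      (forall w, stop (x :: w) -> F w <= 0) ->
      (forall w, ~~ stop (x :: w) ->
         F w <= 1 + \sum_y K (last x w) y * F (rcons w y)) ->
      F [::] <= r].
Proof.
move=> G0 HG.
have B t : \sum_(0 <= i < t) q i <= G [::].
  by apply: le_trans (sum_survival_le G0 HG t); rewrite lerDl run_sum_ge0.
have [r [Er rG qr]] := expected_stop_real B.
exists r; split=> // F M FM F0 HF.
have c : ((r + M * q t) @[t --> \oo] --> r)%classic.
  rewrite -[X in (_ --> X)%classic]addr0; apply: cvgD; first exact: cvg_cst.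
  by rewrite -[X in (_ --> X)%classic](mulr0 M); apply: cvgMr; exact: survival_cvg0 B.
apply: (ler_cvg_to (@cvg_cst _ (F [::]) _ \oo%classic _) c); near=> t.
apply: le_trans (le_sum_survival F0 HF t) _; apply: lerD => //.
rewrite /run_sum mulr_sumr; apply: ler_sum => w _.
by rewrite mulr1 mulrC ler_wpM2r ?path_prob_ge0.
Unshelve. all: by end_near. Qed.

End StoppingBounds.
(** * Hitting times *)

(** A square matrix with trivial kernel is invertible. Functions become row vectors multiplied on
    the right, so [A] is the transpose of [k]. *)
Lemma linear_system_solvable (F : fieldType) (V : finType) (k : V -> V -> F) :
  (forall f : V -> F, (forall x, \sum_y k x y * f y = 0) -> forall x, f x = 0) ->
  forall b : V -> F, exists f : V -> F, forall x, \sum_y k x y * f y = b x.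
Proof.
move=> inj b.
pose A : 'M[F]_#|V| := \matrix_(i, j) k (enum_val j) (enum_val i).
have mulE (u : 'rV_#|V|) (x : V) :
    (u *m A) 0 (enum_rank x) = \sum_y k x y * u 0 (enum_rank y).
  rewrite mxE (reindex_onto (@enum_rank V) enum_val) => [|i _]; last exact: enum_valK.
  under eq_bigl => y do rewrite enum_rankK eqxx.
  by apply: eq_bigr => y _; rewrite mxE !enum_rankK mulrC.
have A_unit : A \in unitmx.
  rewrite -row_free_unit; apply: inj_row_free => u uA.
  apply/rowP => i; rewrite mxE -(enum_valK i).
  apply: (inj (fun x => u 0 (enum_rank x))) => x.
  by rewrite -mulE uA mxE.
exists (fun x => ((\row_i b (enum_val i)) *m invmx A) 0 (enum_rank x)) => x.
by rewrite -mulE mulmxKV // mxE enum_rankK.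
Qed.

(** The sum of c (f - t g)^2 is a nonnegative quadratic in t, so its discriminant is not
    positive. *)
Lemma double_sum_cauchy_schwarz (R : realFieldType) (I : finType)
    (c f g : I -> I -> R) :
  (forall x y, 0 <= c x y) ->
  (\sum_x \sum_y c x y * (f x y * g x y)) ^+ 2 <=
  (\sum_x \sum_y c x y * f x y ^+ 2) * (\sum_x \sum_y c x y * g x y ^+ 2).
Proof.
move=> c0.
set B := \sum_x _; set A := \sum_x _; set D := \sum_x _.
have quad t : 0 <= A - 2 * t * B + t ^+ 2 * D.
  have <- : \sum_x \sum_y c x y * (f x y - t * g x y) ^+ 2 = A - 2 * t * B + t ^+ 2 * D.
    rewrite /A /B /D !mulr_sumr -sumrB -big_split /=; apply: eq_bigr => x _.
    rewrite !mulr_sumr -sumrB -big_split /=; apply: eq_bigr => y _; ring.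
  by do 2![apply: sumr_ge0 => ? _]; rewrite mulr_ge0 ?sqr_ge0.
have D0 : 0 <= D by do 2![apply: sumr_ge0 => ? _]; rewrite mulr_ge0 ?sqr_ge0.
have A0 : 0 <= A by do 2![apply: sumr_ge0 => ? _]; rewrite mulr_ge0 ?sqr_ge0.
have [DE|Dn0] := eqVneq D 0.
  rewrite DE mulr0; have [->|Bn0] := eqVneq B 0; first by rewrite expr0n.
  (* With D = 0 the quadratic is affine in t, and this t makes it equal to -1. *)
  have := quad ((A + 1) / (2 * B)); rewrite DE mulr0 addr0.
  have -> : A - 2 * ((A + 1) / (2 * B)) * B = -1 by field.
  lra.
have := quad (B / D).
have -> : A - 2 * (B / D) * B + (B / D) ^+ 2 * D = (A * D - B ^+ 2) / D by field.
by rewrite pmulr_lge0 ?subr_ge0 // invr_gt0 lt_def Dn0.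
Qed.

Section Walk.
Variables (R : realType) (V : finType) (e : rel V).
Hypothesis e_sym : symmetric e.
Hypothesis e_irr : irreflexive e.
Hypothesis e_conn : forall x y : V, connect e x y.
Hypothesis V_gt1 : (2 <= #|V|)%N.

Local Notation P := (nbr_prob R e).
Local Notation d x := ((deg e x)%:R : R).

(** * Laplacian and Dirichlet form of the graph *)

Definition adj (x y : V) : R := (e x y)%:R.

Definition vol : R := \sum_x \sum_y adj x y.

Definition lap (f : V -> R) (x : V) : R := \sum_y adj x y * (f x - f y).

(** The sum runs over ordered pairs, so this is twice the usual Dirichlet form. *)
Definition energy (f g : V -> R) : R :=
  \sum_x \sum_y adj x y * ((f x - f y) * (g x - g y)).

Lemma deg_gt0 x : (0 < deg e x)%N.
Proof.
have [y yx] : exists y, y != x.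
  have : (0 < #|predC1 x|)%N by rewrite cardC1 -subn1 subn_gt0.
  by move=> /card_gt0P[y yx]; exists y.
have /connectP[[|z p] /=] := e_conn x y; first by move=> _ E; rewrite E eqxx in yx.
by move=> /andP[xz _] _; apply/card_gt0P; exists z; rewrite inE.
Qed.

Lemma degR_gt0 x : 0 < d x. Proof. by rewrite ltr0n deg_gt0. Qed.

Lemma adj_ge0 x y : 0 <= adj x y. Proof. exact: ler0n. Qed.

Lemma adj_sym x y : adj x y = adj y x. Proof. by rewrite /adj e_sym. Qed.

Lemma adj_sum x : \sum_y adj x y = d x.
Proof.
rewrite /deg -sum1dep_card natr_sum [RHS]big_mkcond /=.
by apply: eq_bigr => y _; rewrite /adj; case: (e x y).
Qed.

Lemma vol_deg : vol = \sum_x d x.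
Proof. by apply: eq_bigr => x _; exact: adj_sum. Qed.

Lemma vol_gt0 : 0 < vol.
Proof.
have /card_gt0P[x _] : (0 < #|V|)%N by apply: leq_trans V_gt1.
rewrite vol_deg (bigD1 x) //= ltr_wpDr ?degR_gt0 //.
by apply: sumr_ge0 => y _; apply: ltW; exact: degR_gt0.
Qed.

Lemma nbr_probE x y : P x y = adj x y / d x.
Proof. by rewrite /nbr_prob /adj; case: e; rewrite ?mul1r ?mul0r. Qed.

Lemma nbr_prob_ge0 x y : 0 <= P x y.
Proof. by rewrite nbr_probE divr_ge0 ?adj_ge0 ?ler0n. Qed.

Lemma nbr_prob_sum1 x : \sum_y P x y = 1.
Proof.
under eq_bigr => y _ do rewrite nbr_probE.
by rewrite -mulr_suml adj_sum divff // gt_eqF ?degR_gt0.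
Qed.

Lemma lapE f x : lap f x = d x * (f x - \sum_y P x y * f y).
Proof.
rewrite /lap mulrBr -adj_sum mulr_suml mulr_sumr -sumrB; apply: eq_bigr => y _.
by rewrite nbr_probE adj_sum; field; rewrite gt_eqF ?degR_gt0.
Qed.

Lemma energy_lap f g : energy f g = 2 * \sum_x f x * lap g x.
Proof.
have E : energy f g = \sum_x f x * lap g x - \sum_x \sum_y adj x y * (f y * (g x - g y)).
  rewrite -sumrB; apply: eq_bigr => x _; rewrite mulr_sumr -sumrB.
  by apply: eq_bigr => y _; ring.
rewrite E exchange_big /= mulr_natl mulr2n; congr (_ + _); rewrite -sumrN.
apply: eq_bigr => x _; rewrite mulr_sumr -sumrN; apply: eq_bigr => y _.
by rewrite (adj_sym y x); ring.
Qed.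

Lemma energyC f g : energy f g = energy g f.
Proof. by apply: eq_bigr => x _; apply: eq_bigr => y _; rewrite [X in _ * X]mulrC. Qed.

Lemma lap_selfadjoint f g : \sum_x f x * lap g x = \sum_x g x * lap f x.
Proof.
by have := energyC f g; rewrite !energy_lap => /mulfI ->.
Qed.

Lemma energy_cauchy_schwarz f g :
  energy f g ^+ 2 <= energy f f * energy g g.
Proof.
apply: (double_sum_cauchy_schwarz (fun x y => f x - f y) (fun x y => g x - g y)).
exact: adj_ge0.
Qed.

(** Minimum principle. At a minimizer other than [v] the average over the neighbors cannot exceed
    the minimum, so all neighbors are minimizers too; by connectedness the minimum is attained at
    [v]. *)
Lemma superharmonic_ge0 v f :
  f v = 0 -> (forall x, x != v -> \sum_y P x y * f y <= f x) ->
  forall x, 0 <= f x.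
Proof.
move=> fv fS.
have [z _ zmin] := arg_minP f (isT : xpredT v).
suff fz : f z = 0 by move=> x; rewrite -fz; exact: zmin.
rewrite -fv; apply/eqP; rewrite eq_sym.
have [//|vz] := boolP (f v == f z).
have cl : fingraph.closed e [pred x | f x == f z].
  apply: (intro_closed (sym_connect_sym e_sym)) => x y xy; rewrite !inE => /eqP fx.
  have xv : x != v by apply: contraNneq vz => <-; rewrite fx.
  have S0 : \sum_y P x y * (f y - f z) = 0.
    apply: le_anti; apply/andP; split.
      have -> : \sum_y P x y * (f y - f z) = \sum_y P x y * f y - f z.
        rewrite -[X in _ - X]mul1r -(nbr_prob_sum1 x) mulr_suml -sumrB.
        by apply: eq_bigr => w _; rewrite mulrBr.
      by rewrite subr_le0 -fx fS.
    by apply: sumr_ge0 => w _; rewrite mulr_ge0 ?nbr_prob_ge0 ?subr_ge0 ?zmin.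
  have /(_ y isT)/eqP : forall w, true -> P x w * (f w - f z) = 0.
    apply: psumr_eq0P S0 => w _.
    by rewrite mulr_ge0 ?nbr_prob_ge0 ?subr_ge0 ?zmin.
  rewrite mulf_eq0 subr_eq0 => /orP[] //.
  by rewrite nbr_probE /adj xy mul1r invr_eq0 gt_eqF ?degR_gt0.
by have := closed_connect cl (e_conn z v); rewrite !inE eqxx (negbTE vz).
Qed.

(** The matrix [k] is I - P with the row of [v] replaced by the boundary condition. Its kernel is
    trivial by the minimum principle applied to f and to -f. *)
Lemma hitting_exists v : exists f : V -> R,
  f v = 0 /\ forall x, x != v -> \sum_y P x y * f y = f x - 1.
Proof.
pose k x y : R := if x == v then (y == v)%:R else (x == y)%:R - P x y.
have kv f : \sum_y k v y * f y = f v.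
  rewrite /k eqxx (bigD1 v) //= eqxx mul1r big1 ?addr0 // => y /negbTE ->.
  by rewrite mul0r.
have kE f x : x != v -> \sum_y k x y * f y = f x - \sum_y P x y * f y.
  move=> /negbTE xv; rewrite /k xv.
  under eq_bigr => y _ do rewrite mulrBl.
  rewrite sumrB; congr (_ - _); rewrite (bigD1 x) //= eqxx mul1r big1 ?addr0 // => y.
  by rewrite eq_sym => /negbTE ->; rewrite mul0r.
have inj f : (forall x, \sum_y k x y * f y = 0) -> forall x, f x = 0.
  move=> fk x; have fv : f v = 0 by rewrite -kv fk.
  have fP y : y != v -> \sum_z P y z * f z = f y.
    by move=> yv; apply/eqP; rewrite eq_sym -subr_eq0 -kE ?fk.
  apply: le_anti; rewrite -oppr_ge0.
  rewrite (superharmonic_ge0 fv) => [|y /fP -> //]; rewrite andbT.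
  apply: (@superharmonic_ge0 v (fun x => - f x)); rewrite ?fv ?oppr0 // => y /fP fy.
  under eq_bigr => z _ do rewrite mulrN.
  by rewrite sumrN fy.
have [f fE] := linear_system_solvable inj (fun x => (x != v)%:R).
exists f; split=> [|x xv]; first by rewrite -kv fE eqxx.
by have := fE x; rewrite kE // xv => /(canRL (subrK _)) ->; rewrite mulr1n addrAC subrr add0r.
Qed.

(* [hit x v] is the expected hitting time of [v] from [x], characterized by its
   first-step equations. *)
Definition hit (x v : V) : R := projT1 (cid (hitting_exists v)) x.

Lemma hit_self v : hit v v = 0.
Proof. by rewrite /hit; case: cid => f []. Qed.

Lemma hit_step x v : x != v -> \sum_y P x y * hit y v = hit x v - 1.
Proof. by rewrite /hit; case: cid => f [_ H] /=; exact: H. Qed.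

Lemma hit_ge0 x v : 0 <= hit x v.
Proof.
apply: (@superharmonic_ge0 v (hit^~ v)); first exact: hit_self.
by move=> y yv; rewrite hit_step // gerBl.
Qed.

(** Away from [v] this is the first-step equation; the value at [v] is then forced because a
    Laplacian sums to 0 over all vertices. *)
Lemma lap_hit v x : lap (hit^~ v) x = d x - (x == v)%:R * vol.
Proof.
have off y : y != v -> lap (hit^~ v) y = d y.
  by move=> yv; rewrite lapE hit_step //; ring.
have [->|xv] := eqVneq x v; last by rewrite off // mul0r subr0.
have : \sum_x 1 * lap (hit^~ v) x = 0.
  rewrite lap_selfadjoint big1 // => y _; rewrite /lap big1 ?mulr0 // => z _.
  by rewrite subrr mulr0.
rewrite (bigD1 v) //= (eq_bigr (fun y => d y)) => [|y yv]; last by rewrite mul1r off.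
by rewrite vol_deg [X in _ -> _ = _ - _ * X](bigD1 v) //=; lra.
Qed.

(** The expected hitting time of [v] from the stationary distribution [d x / vol]. *)
Definition kappa (v : V) : R := (\sum_x d x * hit x v) / vol.

(** Pairing the hitting time of a with the Laplacian of that of b gives vol (kappa(a) - H(b,a)), and
    self-adjointness makes this symmetric in a and b. *)
Lemma hit_asym u v : hit u v - hit v u = kappa v - kappa u.
Proof.
have E a b : \sum_x hit x a * lap (hit^~ b) x = vol * (kappa a - hit b a).
  under eq_bigr => x _ do rewrite lap_hit mulrBr.
  rewrite sumrB mulrBr; congr (_ - _).
    rewrite /kappa mulrC divfK ?gt_eqF ?vol_gt0 //.
    by apply: eq_bigr => x _; rewrite mulrC.
  rewrite (bigD1 b) //= eqxx mul1r mulrC big1 ?addr0 // => x /negbTE ->.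
  by rewrite mul0r mulr0.
have := E u v; rewrite lap_selfadjoint E => /mulfI; rewrite gt_eqF ?vol_gt0 // => /(_ isT).
lra.
Qed.

(** The function [phi] is the potential of a current of strength [vol] between u and v, so its
    pairing with any g is vol (g(u) - g(v)). Apply Cauchy-Schwarz to [f] and [phi]. *)
Lemma commute_energy_bound u v f :
  2 * vol * (f u - f v) ^+ 2 <= (hit u v + hit v u) * energy f f.
Proof.
have [->|uv] := eqVneq u v.
  rewrite subrr expr0n mulr0 hit_self addr0 mul0r; exact: lexx.
pose phi x := hit x v - hit x u.
have lap_phi x : lap phi x = vol * ((x == u)%:R - (x == v)%:R).
  have -> : lap phi x = lap (hit^~ v) x - lap (hit^~ u) x.
    by rewrite /lap -sumrB; apply: eq_bigr => y _; rewrite /phi; ring.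
  by rewrite !lap_hit; ring.
have pairing g : \sum_x g x * lap phi x = vol * (g u - g v).
  under eq_bigr => x _ do rewrite lap_phi.
  rewrite (bigD1 u) //= (bigD1 v) /=; last by rewrite eq_sym.
  rewrite !eqxx (eq_sym v u) (negbTE uv).
  rewrite big1 => [|x /andP[/negbTE -> /negbTE ->]]; first by rewrite addr0 !mulr1n !mulr0n; ring.
  by rewrite subrr !mulr0.
have := energy_cauchy_schwarz f phi.
have -> : energy f phi = 2 * (vol * (f u - f v)) by rewrite energy_lap pairing.
have -> : energy phi phi = 2 * (vol * (hit u v + hit v u)).
  by rewrite energy_lap pairing /phi !hit_self; ring.
have v0 : 0 < 2 * vol by rewrite mulr_gt0 ?vol_gt0.
move=> H; rewrite -(ler_pM2l v0).
have -> : 2 * vol * (2 * vol * (f u - f v) ^+ 2) = (2 * (vol * (f u - f v))) ^+ 2 by ring.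
apply: le_trans H _; rewrite le_eqVlt; apply/orP; left; apply/eqP; ring.
Qed.

(** The test function is the indicator of [v], whose energy is 2 deg v. *)
Lemma commute_ge_vol_deg u v : u != v -> vol <= (hit u v + hit v u) * d v.
Proof.
move=> uv; have := commute_energy_bound u v (fun x => (x == v)%:R).
rewrite (negbTE uv) eqxx sub0r sqrrN expr1n mulr1.
rewrite energy_lap (bigD1 v) //= eqxx mul1r big1 => [|x /negbTE ->]; last by rewrite mul0r.
have -> : lap (fun x => (x == v)%:R) v = d v.
  rewrite /lap -adj_sum; apply: eq_bigr => y _; rewrite eqxx.
  have [->|_] := eqVneq y v; last by rewrite subr0 mulr1.
  by rewrite /adj e_irr mul0r.
by rewrite addr0; lra.
Qed.

(** A 1-Lipschitz function has energy at most [vol]. *)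
Lemma commute_ge_lipschitz u v f :
  (forall x y, e x y -> `|f x - f y| <= 1) ->
  2 * (f u - f v) ^+ 2 <= hit u v + hit v u.
Proof.
move=> lip; rewrite -(ler_pM2r vol_gt0) mulrAC.
apply: le_trans (commute_energy_bound u v f) _.
rewrite ler_wpM2l ?addr_ge0 ?hit_ge0 //.
apply: ler_sum => x _; apply: ler_sum => y _; rewrite /adj.
case: (boolP (e x y)) => [/lip|_]; last by rewrite mul0r.
by rewrite mul1r -expr2 -real_normK ?num_real // => H; rewrite expr_le1.
Qed.

(** * Cover time *)

Section CoverTime.
Variable s : V.

Definition unvisited (w : seq V) : {set V} := [set v | v \notin s :: w].

Lemma unvisited_rcons w y : unvisited (rcons w y) = unvisited w :\ y.
Proof. by apply/setP => v; rewrite in_setD1 !in_set -rcons_cons mem_rcons in_cons negb_or. Qed.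

Lemma last_visited w : last s w \notin unvisited w.
Proof. by rewrite inE negbK mem_last. Qed.

Lemma all_visitedE w : all_visited (s :: w) = (unvisited w == set0).
Proof.
apply/forallP/eqP => [H|U0 v].
  by apply/setP => v; rewrite in_set in_set0; apply/negbF; exact: H.
by have := in_set0 v; rewrite -U0 in_set => /negbFE.
Qed.

Lemma sum_hit_setD1 (B : {set V}) y :
  \sum_(v in B :\ y) hit y v = \sum_(v in B) hit y v.
Proof.
have [yB|yB] := boolP (y \in B); last by rewrite (setDidPl _) // disjoint_sym disjoints1.
by rewrite [RHS](big_setD1 y) //= hit_self add0r.
Qed.

Lemma sum_hit_step x (B : {set V}) : x \notin B ->
  \sum_y P x y * (\sum_(v in B) hit y v) = \sum_(v in B) hit x v - #|B|%:R.
Proof.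
move=> xB.
under eq_bigr => y _ do rewrite mulr_sumr.
rewrite exchange_big /= -sumr_const -sumrB; apply: eq_bigr => v vB.
by rewrite hit_step //; apply: contraNneq xB => ->.
Qed.

(** This is 1/2 + ... + 1/k, the harmonic number without its first term; in [matthews] the average
    hitting time takes the place of that term. *)
Definition harm (k : nat) : R := \sum_(1 <= i < k) i.+1%:R^-1.

(* The value at (x, B) is the bound on the expected time to visit [B] from [x]
   given by Matthews' random-order argument, in which the j-th vertex of a random
   order costs at least [K] with probability 1/j. *)
Definition matthews (K : R) (x : V) (B : {set V}) : R :=
  #|B|%:R^-1 * (\sum_(v in B) hit x v) + K * harm #|B|.

(** With k = |B \ y| and T the sum of the hitting times from y in B, the gain is (T - k K) / (k (k +
    1)), and each of the k nonzero-target terms of T is at least [K]. *)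
Lemma matthews_setD1 (K : R) (B : {set V}) y :
  (forall u v, u \in B -> v \in B -> u != v -> K <= hit u v) ->
  #|B|%:R^-1 * (\sum_(v in B) hit y v) + K * harm #|B| <= matthews K y (B :\ y).
Proof.
move=> HK; rewrite /matthews sum_hit_setD1.
have [yB|yB] := boolP (y \in B); last by rewrite (setDidPl _) // disjoint_sym disjoints1.
rewrite (cardsD1 y B) yB add1n.
set k := #|B :\ y|; rewrite -sum_hit_setD1.
have [k0|k0] := posnP k.
  have -> : B :\ y = set0 by apply: cards0_eq.
  by rewrite k0 /harm !big_geq // big_set0 !mulr0.
have -> : harm k.+1 = harm k + k.+1%:R^-1 by rewrite /harm big_nat_recr.
have T_ge : k%:R * K <= \sum_(v in B :\ y) hit y v.
  rewrite mulr_natl -sumr_const; apply: ler_sum => v; rewrite !inE => /andP[vy vB].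
  by apply: HK; rewrite // eq_sym.
set T := \sum_(v in _) _ in T_ge *.
have kR : 0 < k%:R :> R by rewrite ltr0n.
have k1R : 0 < k.+1%:R :> R by rewrite ltr0n.
rewrite -subr_ge0.
have -> : k%:R^-1 * T + K * harm k - (k.+1%:R^-1 * T + K * (harm k + k.+1%:R^-1)) =
   (T - k%:R * K) / (k%:R * k.+1%:R).
  by rewrite -natr1; field; rewrite natr1 !gt_eqF.
by apply: divr_ge0; [rewrite subr_ge0 | rewrite ltW ?mulr_gt0].
Qed.

Lemma finite_bound (T : finType) (phi : T -> R) t : phi t <= \sum_t `|phi t|.
Proof.
rewrite (bigD1 t) //= (le_trans (ler_norm _)) // lerDl.
by apply: sumr_ge0 => ? _; exact: normr_ge0.
Qed.

(** Finiteness comes from the supersolution summing [hit] over the unvisited vertices: each summand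
    drops by 1 per step, and there is at least one before covering. Subsolutions need only the
    current vertex and the unvisited set. *)
Lemma COVs_bounds : exists r : R, COVs R e s = r%:E /\
  forall phi : V -> {set V} -> R,
    (forall x, phi x set0 <= 0) ->
    (forall x (B : {set V}), x \notin B -> B != set0 ->
       phi x B <= 1 + \sum_y P x y * phi y (B :\ y)) ->
    phi s [set~ s] <= r.
Proof.
pose G w := \sum_(v in unvisited w) hit (last s w) v.
have G_ge0 w : 0 <= G w by apply: sumr_ge0 => v _; exact: hit_ge0.
have G_super w : path_prob P s w != 0 -> ~~ all_visited (s :: w) ->
    1 + \sum_y P (last s w) y * G (rcons w y) <= G w.
  move=> _; rewrite all_visitedE -card_gt0 => U0.
  rewrite /G; under eq_bigr => y _ do
    rewrite unvisited_rcons last_rcons sum_hit_setD1.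
  rewrite sum_hit_step ?last_visited // addrC -addrA gerDl addrC subr_le0.
  by rewrite ler1n.
have [r [Er _ HF]] := expected_stop_bounds nbr_prob_ge0 nbr_prob_sum1 G_ge0 G_super.
exists r; split=> // phi phi0 phi_sub.
have -> : [set~ s] = unvisited [::] by apply/setP => v; rewrite !inE.
apply: (HF (fun w => phi (last s w) (unvisited w))
           (\sum_(xB : V * {set V}) `|phi xB.1 xB.2|)) => w.
- exact: (finite_bound (fun xB : V * {set V} => phi xB.1 xB.2) (_, _)).
- by rewrite all_visitedE => /eqP ->.
- rewrite all_visitedE => U0; apply: le_trans (phi_sub _ _ (last_visited w) U0) _.
  by rewrite lerD2l; apply: ler_sum => y _; rewrite unvisited_rcons last_rcons.
Qed.

(** The subsolution is [hit x v] while [v] is unvisited and 0 afterwards. *)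
Lemma hit_le_COVs v : hit s v <= fine (COVs R e s).
Proof.
have [r [-> Hr]] := COVs_bounds.
have phi_sub x (B : {set V}) : x \notin B -> B != set0 ->
   (v \in B)%:R * hit x v <= 1 + \sum_y P x y * ((v \in B :\ y)%:R * hit y v).
  move=> xB _.
  have -> : \sum_y P x y * ((v \in B :\ y)%:R * hit y v) =
            (v \in B)%:R * \sum_y P x y * hit y v.
    rewrite mulr_sumr; apply: eq_bigr => y _; rewrite !inE.
    have [->|_] := eqVneq v y; first by rewrite hit_self !mulr0.
    by rewrite mulrCA.
  case: (boolP (v \in B)) => vB; last by rewrite !mul0r addr0.
  rewrite !mul1r hit_step; last by apply: contraNneq xB => ->.
  by rewrite addrC subrK.
have phi0 x : (v \in (set0 : {set V}))%:R * hit x v <= 0 by rewrite inE mul0r.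
apply: le_trans (Hr (fun x B => (v \in B)%:R * hit x v) phi0 phi_sub).
by rewrite !inE; have [->|_] := eqVneq v s; rewrite ?hit_self ?mulr0 ?mul1r.
Qed.

(** The subsolution is [matthews] on the unvisited part of [A]. Initially this is A without s, where
    the average hitting time is at least [K] and supplies the first harmonic term. *)
Lemma matthews_le_COVs (A : {set V}) (K : R) : s \in A ->
  (forall u v, u \in A -> v \in A -> u != v -> K <= hit u v) ->
  K * (\sum_(0 <= i < #|A|.-1) i.+1%:R^-1) <= fine (COVs R e s).
Proof.
move=> sA HK; have [r [-> Hr]] := COVs_bounds.
pose phi x B := matthews K x (B :&: A).
have phi0 x : phi x set0 <= 0.
  by rewrite /phi set0I /matthews /harm cards0 big_geq // big_set0 !mulr0 addr0.
have phi_sub x (B : {set V}) : x \notin B -> B != set0 ->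
    phi x B <= 1 + \sum_y P x y * phi y (B :\ y).
  move=> xB _; rewrite /phi; set D := B :&: A.
  have xD : x \notin D by rewrite inE negb_and xB.
  have HK' u v : u \in D -> v \in D -> u != v -> K <= hit u v.
    by rewrite !inE => /andP[_ uA] /andP[_ vA]; exact: HK.
  pose psi y := #|D|%:R^-1 * (\sum_(v in D) hit y v) + K * harm #|D|.
  have DE y : (B :\ y) :&: A = D :\ y by apply/setP => v; rewrite !inE andbA.
  apply: (@le_trans _ _ (1 + \sum_y P x y * psi y)); last first.
    rewrite lerD2l; apply: ler_sum => y _; rewrite DE ler_wpM2l ?nbr_prob_ge0 //.
    exact: matthews_setD1.
  have -> : \sum_y P x y * psi y =
      #|D|%:R^-1 * (\sum_(v in D) hit x v - #|D|%:R) + K * harm #|D|.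
    under eq_bigr => y _ do rewrite mulrDr mulrCA.
    by rewrite big_split /= -mulr_sumr sum_hit_step // -mulr_suml nbr_prob_sum1 mul1r.
  (* For empty [D] the average term is 0 because 0^-1 = 0; otherwise the average drops by exactly
     1. *)
  rewrite /matthews; have [D0|D0] := posnP #|D|; first by rewrite D0 invr0 !mul0r add0r lerDr.
  by rewrite mulrBr mulVf ?pnatr_eq0 -?lt0n // addrA [1 + _]addrC subrK.
apply: le_trans (Hr phi phi0 phi_sub).
rewrite /phi /matthews.
have -> : [set~ s] :&: A = A :\ s by apply/setP => v; rewrite !inE.
have -> : #|A|.-1 = #|A :\ s| by rewrite (cardsD1 s A) sA.
set k := #|_|; have [k0|k0] := posnP k.
  by rewrite k0 /harm !big_geq // invr0 mul0r mulr0 addr0.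
rewrite big_ltn // invr1 mulrDr mulr1 lerD2r mulrC ler_pdivlMr ?ltr0n //.
rewrite mulr_natr -sumr_const; apply: ler_sum => v; rewrite !inE => /andP[vs vA].
by apply: HK; rewrite // eq_sym.
Qed.
End CoverTime.

(** * The push algorithm *)

Definition nbhd (A : {set V}) : {set V} := A :|: [set y | [exists x in A, e x y]].

Definition ball (k : nat) (A : {set V}) : {set V} := iter k nbhd A.

(* Junk value 0 when [A] is empty. *)
Definition gdist (A : {set V}) (v : V) : nat :=
  if pselect (exists k, v \in ball k A) is left h then ex_minn h else 0%N.

Lemma nbhdS (A B : {set V}) : A \subset B -> nbhd A \subset nbhd B.
Proof.
move=> /subsetP AB; apply/subsetP => v; rewrite !inE => /orP[/AB -> //|].
move=> /existsP[x /andP[/AB xB xv]]; apply/orP; right.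
by apply/existsP; exists x; rewrite xB.
Qed.

Lemma ballS k (A B : {set V}) : A \subset B -> ball k A \subset ball k B.
Proof. by move=> AB; elim: k => //= k; exact: nbhdS. Qed.

Lemma ball_leq k l (A : {set V}) : (k <= l)%N -> ball k A \subset ball l A.
Proof.
move=> /subnK <-; elim: (l - k)%N => //= m IH.
by apply: subset_trans IH _; exact: subsetUl.
Qed.

Lemma ball_reach (A : {set V}) v : A != set0 -> exists k, v \in ball k A.
Proof.
move=> /set0Pn[x xA]; have /connectP[p] := e_conn x v.
elim/last_ind: p v => [|p y IH] v /=; first by move=> _ ->; exists 0%N.
rewrite rcons_path last_rcons => /andP[xp py] ->.
have [k kp] := IH _ xp erefl; exists k.+1; rewrite /= !inE; apply/orP; right.
by apply/existsP; exists (last x p); rewrite kp.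
Qed.

Lemma gdist_le (A : {set V}) v k : A != set0 -> (gdist A v <= k)%N = (v \in ball k A).
Proof.
move=> A0; rewrite /gdist; case: pselect => [h|[]]; last exact: ball_reach.
case: ex_minnP => m vm mmin; apply/idP/idP => [mk|]; last exact: mmin.
exact: subsetP (ball_leq A mk) _ vm.
Qed.

Lemma gdist_eq0 (A : {set V}) v : A != set0 -> (gdist A v == 0%N) = (v \in A).
Proof. by move=> A0; rewrite -leqn0 gdist_le. Qed.

Lemma gdistS (A B : {set V}) v : A != set0 -> A \subset B -> (gdist B v <= gdist A v)%N.
Proof.
move=> A0 AB; rewrite gdist_le; last first.
  by apply: contraNneq A0 => B0; rewrite -subset0 -B0.
by apply: subsetP (ballS _ AB) _ _; rewrite -gdist_le.
Qed.

Lemma gdist_adj (A : {set V}) x y : A != set0 -> e x y -> (gdist A y <= (gdist A x).+1)%N.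
Proof.
move=> A0 xy; rewrite gdist_le //= !inE; apply/orP; right.
by apply/existsP; exists x; rewrite -gdist_le // leqnn.
Qed.

Lemma gdist_lipschitz (A : {set V}) x y : A != set0 -> e x y ->
  `|(gdist A x)%:R - (gdist A y)%:R| <= 1 :> R.
Proof.
move=> A0 xy; rewrite ler_distl lerBlDr !natr1 !ler_nat gdist_adj //=.
by rewrite gdist_adj // e_sym.
Qed.

Lemma ball_source k (A : {set V}) v : v \in ball k.+1 A -> v \notin ball k A ->
  exists x y, [/\ x \in A, e x y & v \in ball k [set y]].
Proof.
elim: k v => [|k IH] v.
  rewrite /= !inE => /orP[-> //|/existsP[x /andP[xA xv]]] _.
  by exists x, v; rewrite inE.
rewrite -[ball k.+2 A]/(nbhd (ball k.+1 A)) inE => /orP[-> //|].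
rewrite inE => /existsP[z /andP[zk zv]] vk.
have zk' : z \notin ball k A.
  apply: contraNN vk => zk'; rewrite /= !inE; apply/orP; right.
  by apply/existsP; exists z; rewrite zk'.
have [x [y [xA xy zy]]] := IH z zk zk'.
exists x, y; split=> //; rewrite /= !inE; apply/orP; right.
by apply/existsP; exists z; rewrite zy.
Qed.

(** The pair (x, y) is the first edge of a shortest path from [A] to [v]. *)
Lemma gdist_source (A : {set V}) v : A != set0 -> v \notin A ->
  exists x y, [/\ x \in A, e x y &
    forall B : {set V}, y \in B -> (gdist B v < gdist A v)%N].
Proof.
move=> A0 vA; have := gdist_eq0 v A0; rewrite (negbTE vA).
case E : (gdist A v) => [|k] // _.
have [||x [y [xA xy vy]]] := @ball_source k A v.
- by rewrite -gdist_le // E.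
- by rewrite -gdist_le // E ltnn.
exists x, y; split=> // B yB; rewrite ltnS gdist_le.
  by apply: subsetP vy; apply: ballS; rewrite sub1set.
by apply/set0Pn; exists y.
Qed.

(** * One round of the push algorithm *)

Section Push.
Variable A : {set V}.
Local Notation I := {v : V | v \in A}.

Definition push_weight (c : {ffun I -> V}) : R := \prod_(v : I) P (val v) (c v).

Definition push_image (c : {ffun I -> V}) : {set V} := A :|: [set c v | v : I].

Lemma push_weight_ge0 c : 0 <= push_weight c.
Proof. by apply: prodr_ge0 => v _; exact: nbr_prob_ge0. Qed.

Lemma push_weight_sum1 : \sum_c push_weight c = 1.
Proof.
rewrite -(bigA_distr_bigA (fun (v : I) u => P (val v) u)) big1 // => v _.
exact: nbr_prob_sum1.
Qed.

Lemma push_weight_edge (x : I) y : e (val x) y ->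
  \sum_(c : {ffun I -> V} | c x == y) push_weight c = (deg e (val x))%:R^-1.
Proof.
move=> xy.
(* The indicator of the event is put into the factor of [x], so that the sum of products
   factorizes. *)
pose F (v : I) u := if v == x then (u == y)%:R * P (val v) u else P (val v) u.
have -> : \sum_(c : {ffun I -> V} | c x == y) push_weight c =
    \sum_(c : {ffun I -> V}) \prod_(v : I) F v (c v).
  rewrite big_mkcond; apply: eq_bigr => c _.
  rewrite /push_weight (bigD1 x) //= [in RHS](bigD1 x) //= /F eqxx.
  have -> : \prod_(v | v != x) (if v == x then (c v == y)%:R * P (val v) (c v)
      else P (val v) (c v)) = \prod_(v | v != x) P (val v) (c v).
    by apply: eq_bigr => v /negbTE ->.
  by case: eqP; rewrite ?mul1r ?mul0r.
rewrite -bigA_distr_bigA (bigD1 x) //= [X in _ * X]big1 ?mulr1; last first.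
  by move=> v /negbTE vx; rewrite /F vx nbr_prob_sum1.
rewrite /F eqxx (bigD1 y) //= eqxx mul1r big1 ?addr0.
  by rewrite nbr_probE /adj xy mul1r.
by move=> u /negbTE ->; rewrite mul0r.
Qed.

Lemma push_expectation (g : {set V} -> R) :
  \sum_B push_prob R e A B * g B = \sum_c push_weight c * g (push_image c).
Proof.
rewrite (partition_big push_image xpredT) //=; apply: eq_bigr => B _.
by rewrite /push_prob mulr_suml; apply: eq_bigr => c /eqP <-.
Qed.

End Push.

Lemma push_prob_ge0 A B : 0 <= push_prob R e A B.
Proof. by apply: sumr_ge0 => c _; exact: push_weight_ge0. Qed.

Lemma push_prob_sum1 A : \sum_B push_prob R e A B = 1.
Proof.
have := push_expectation A (fun=> 1).
under eq_bigr => B _ do rewrite mulr1.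
by under [X in _ = X -> _]eq_bigr => c _ do rewrite mulr1; rewrite push_weight_sum1.
Qed.

Lemma push_prob_sub A B : push_prob R e A B != 0 -> A \subset B.
Proof.
apply: contraNT => AB; rewrite /push_prob big1 // => c /eqP cB.
by rewrite -cB subsetUl in AB.
Qed.

Local Notation Delta := ((max_deg e)%:R : R).

Lemma deg_le_max x : d x <= Delta.
Proof. by rewrite ler_nat /max_deg (leq_bigmax x). Qed.

Lemma max_deg_gt0 : 0 < Delta.
Proof.
have /card_gt0P[x _] : (0 < #|V|)%N by apply: leq_trans V_gt1.
exact: lt_le_trans (degR_gt0 x) (deg_le_max x).
Qed.

(* [2 ^ k - 1] loses at least half of its value when [k >= 1] decreases, and it
   vanishes exactly when everybody is informed. *)
Definition excess (A : {set V}) : R := \sum_v (2 ^+ gdist A v - 1).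

Lemma excess_ge0 A : 0 <= excess A.
Proof. by apply: sumr_ge0 => v _; rewrite subr_ge0 exprn_ege1 // ler1n. Qed.

(** An uninformed vertex contributes at least 2 - 1. Hence [ln (excess A)] is nonnegative until the
    broadcast ends. *)
Lemma excess_ge1 (A : {set V}) : A != set0 -> A != setT -> 1 <= excess A.
Proof.
move=> A0 /eqP AT; have [v vA] : exists v, v \notin A.
  apply/existsP; rewrite -negb_forall; apply/negP => /forallP H.
  by apply: AT; apply/setP => v; rewrite inE H.
rewrite /excess (bigD1 v) //= -[1 in leLHS]addr0; apply: lerD.
  have := gdist_eq0 v A0; rewrite (negbTE vA); case: gdist => // k _.
  rewrite exprS lerBrDr; have : 1 <= 2 ^+ k :> R by rewrite exprn_ege1 // ler1n.
  lra.
by apply: sumr_ge0 => w _; rewrite subr_ge0 exprn_ege1 // ler1n.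
Qed.

(** The bound holds for each vertex v. If v is at distance k + 1, the first edge of a shortest path
    to it is used with probability at least 1/Delta, and this saves 2^k, at least half of 2^(k+1) -
    1. *)
Lemma excess_push (A : {set V}) : A != set0 ->
  \sum_c push_weight c * excess (@push_image A c) <=
  excess A * (1 - (2 * Delta)^-1).
Proof.
move=> A0; under eq_bigr => c _ do rewrite /excess mulr_sumr.
rewrite exchange_big /= /excess mulr_suml; apply: ler_sum => v _.
have mono c : (2 : R) ^+ gdist (@push_image A c) v <= 2 ^+ gdist A v.
  by rewrite ler_weXn2l ?ler1n // gdistS // subsetUl.
have [vA|vA] := boolP (v \in A).
  rewrite big1 => [|c _].
    have -> : gdist A v = 0%N by apply/eqP; rewrite gdist_eq0.
    by rewrite expr0 subrr mul0r.
  have := mono c; have -> : gdist A v = 0%N by apply/eqP; rewrite gdist_eq0.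
  rewrite expr0 => le1; have ge1 : 1 <= 2 ^+ gdist (@push_image A c) v :> R.
    by rewrite exprn_ege1 // ler1n.
  by rewrite (@le_anti _ _ (2 ^+ _) 1) ?subrr ?mulr0 // le1 ge1.
have [x [y [xA xy yB]]] := gdist_source A0 vA.
pose x' : {v | v \in A} := exist _ x xA.
have := yB [set y] (set11 y); case E : (gdist A v) => [|k] // _.
have gain c : push_weight c * (2 ^+ gdist (push_image c) v - 1) <=
    push_weight c * (2 ^+ k.+1 - 1) - (if c x' == y then push_weight c * 2 ^+ k else 0).
  have w0 := push_weight_ge0 c; case: eqP => [cxy|_]; last first.
    by rewrite subr0 ler_wpM2l // lerB // -E.
  rewrite -mulrBr ler_wpM2l // addrAC lerB // exprS.
  have -> : 2 * 2 ^+ k - 2 ^+ k = 2 ^+ k :> R by ring.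
  rewrite ler_weXn2l ?ler1n // -ltnS -E yB // inE; apply/orP; right.
  by apply/imsetP; exists x'.
apply: le_trans (ler_sum _ (fun c _ => gain c)) _.
rewrite sumrB -mulr_suml push_weight_sum1 mul1r -big_mkcond -mulr_suml push_weight_edge //.
rewrite mulrBr mulr1 lerD2l lerN2 /=.
apply: (@le_trans _ _ (Delta^-1 * 2 ^+ k)); last first.
  by rewrite ler_wpM2r ?exprn_ge0 // lef_pV2 ?deg_le_max ?posrE ?degR_gt0 ?max_deg_gt0.
have De0 := max_deg_gt0.
rewrite ler_pdivrMr ?mulr_gt0 //.
have -> : Delta^-1 * 2 ^+ k * (2 * Delta) = 2 ^+ k.+1 by rewrite exprS; field; rewrite gt_eqF.
by rewrite gerBl.
Qed.

Lemma RBAs_bounds (s : V) (D : nat) : (forall v, gdist [set s] v <= D)%N ->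
  exists r : R, [/\ RBAs R e s = r%:E, 1 <= r &
    r <= 2 * Delta * (1 + (ln #|V|%:R + D%:R))].
Proof.
move=> HD.
have De0 := max_deg_gt0.
have sT : [set s] != setT.
  by rewrite eqEcard negb_and -ltnNge cards1 cardsT V_gt1 orbT.
(* The test [s \in A] excludes the empty set, so [excess_ge1] gives nonnegativity; by [s_last] it
   succeeds on all trajectories of positive probability. *)
pose g (A : {set V}) : R :=
  if (s \in A) && (A != setT) then 2 * Delta * (1 + ln (excess A)) else 0.
have ln_excess_ge0 (A : {set V}) : s \in A -> A != setT -> 0 <= ln (excess A).
  by move=> sA AT; rewrite ln_ge0 // excess_ge1 //; apply/set0Pn; exists s.
pose G w := g (last [set s] w).
have G0 w : 0 <= G w.
  rewrite /G /g; case: ifP => // /andP[sA AT].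
  by apply: mulr_ge0; [rewrite mulr_ge0 ?ltW | rewrite addr_ge0 ?ln_excess_ge0].
have s_last w : path_prob (push_prob R e) [set s] w != 0 -> s \in last [set s] w.
  elim/last_ind: w => [|w B IH]; first by rewrite inE.
  rewrite path_prob_rcons last_rcons mulf_eq0 negb_or => /andP[/IH sw /push_prob_sub].
  by move/subsetP; apply.
have G_super w : path_prob (push_prob R e) [set s] w != 0 ->
    ~~ all_informed ([set s] :: w) ->
    1 + \sum_B push_prob R e (last [set s] w) B * G (rcons w B) <= G w.
  move=> /s_last sA; rewrite /all_informed /= /G => AT.
  under eq_bigr => B _ do rewrite last_rcons.
  move: sA AT; set A := last _ _ => sA AT.
  have A0 : A != set0 by apply/set0Pn; exists s.
  have L0 := ln_excess_ge0 A sA AT.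
  have X1 := excess_ge1 A0 AT.
  have X0 : 0 < excess A by apply: lt_le_trans X1.
  rewrite push_expectation {2}/g sA AT /=.
  (* With B the next informed set and r = excess(B) / excess(A), use 1 + ln r <= r. The result is
     linear in excess(B), so [excess_push] bounds its mean; when B is everything, the left side is
     0. *)
  have step c : g (@push_image A c) <=
      2 * Delta * (ln (excess A) + excess (push_image c) / excess A).
    rewrite /g inE sA /=; case: (boolP (_ == _)) => [_|BT] /=.
      apply: mulr_ge0; first by rewrite mulr_ge0 ?ltW.
      by rewrite addr_ge0 // divr_ge0 ?excess_ge0 // ltW.
    have B0 : push_image c != set0 by apply/set0Pn; exists s; rewrite inE sA.
    have XB : 0 < excess (push_image c) by apply: lt_le_trans (excess_ge1 B0 BT).
    rewrite ler_wpM2l ?(mulr_ge0 _ (ltW De0)) //.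
    have := @le_ln1Dx R (excess (push_image c) / excess A - 1).
    rewrite (addrC 1) subrK ln_div ?posrE // ltrBrDr addNr divr_gt0 // => /(_ isT).
    lra.
  have : \sum_c push_weight c * g (@push_image A c) <=
      2 * Delta * (ln (excess A) + (1 - (2 * Delta)^-1)).
    apply: le_trans (ler_sum _ (fun c _ => ler_wpM2l (push_weight_ge0 c) (step c))) _.
    under eq_bigr => c _ do rewrite mulrCA mulrDr mulrA.
    rewrite -mulr_sumr ler_wpM2l ?(mulr_ge0 _ (ltW De0)) // big_split /= -!mulr_suml.
    rewrite push_weight_sum1 mul1r lerD2l ler_pdivrMr // mulrC.
    exact: excess_push.
  have -> : 2 * Delta * (ln (excess A) + (1 - (2 * Delta)^-1)) =
    2 * Delta * (1 + ln (excess A)) - 1 by field; rewrite gt_eqF.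
  lra.
have [r [Er rG HF]] := expected_stop_bounds push_prob_ge0 push_prob_sum1 G0 G_super.
exists r; split=> //.
  (* At least one round is needed; this keeps the denominator of the ratio positive. *)
  pose F w : R := (last [set s] w != setT)%:R.
  apply: le_trans (HF F 1 _ _ _).
  - by rewrite /F /= sT.
  - by move=> w; rewrite /F; case: eqP.
  - by move=> w; rewrite /all_informed /= /F => /eqP ->; rewrite eqxx.
  - move=> w _; apply: (@le_trans _ _ 1); first by rewrite /F; case: eqP.
    by rewrite lerDl; apply: sumr_ge0 => B _; rewrite mulr_ge0 ?push_prob_ge0 ?ler0n.
apply: le_trans rG _; rewrite /G /= /g set11 sT /=.
rewrite ler_wpM2l ?(mulr_ge0 _ (ltW De0)) // lerD2l.
have X1 : 1 <= excess [set s] by apply: excess_ge1 sT; apply/set0Pn; exists s; rewrite set11.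
have nR : 0 < #|V|%:R :> R by rewrite ltr0n (leq_trans _ V_gt1).
have X_le : excess [set s] <= #|V|%:R * 2 ^+ D.
  rewrite mulr_natl -sumr_const; apply: ler_sum => v _.
  by rewrite lerBlDr (le_trans (_ : _ <= 2 ^+ D)) ?lerDl // ler_weXn2l ?ler1n.
apply: (@le_trans _ _ (ln (#|V|%:R * 2 ^+ D))).
  by rewrite ler_ln ?posrE ?mulr_gt0 ?exprn_gt0 // (lt_le_trans _ X1).
rewrite lnM ?posrE ?exprn_gt0 // lerD2l lnXn // ler_wMn2r //.
by apply: (@le_ln1Dx R 1); rewrite (lt_trans (ltrN10 R)).
Qed.

(** * Combining the estimates *)

(** The maximum is attained, so [fine] of it is the value at some vertex. *)
Lemma bigmaxe_real (f : V -> \bar R) : (forall s, exists r : R, f s = r%:E) ->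
  exists z, \big[maxe/-oo%E]_s f s = f z /\ forall s, fine (f s) <= fine (f z).
Proof.
move=> f_real; have /card_gt0P[x _] : (0 < #|V|)%N by apply: leq_trans V_gt1.
have E := bigmax_eq_arg -oo%E x xpredT f isT (fun s _ => leNye (f s)).
eexists; split; first exact: E.
move=> s; rewrite -E; have := le_bigmax -oo%E f s; rewrite E.
have [a ->] := f_real s; set z := Order.arg_max _ _ _.
by have [b ->] := f_real z; rewrite lee_fin.
Qed.

Lemma pigeonhole (T I : finType) (b : T -> I) (A : {set T}) : A != set0 ->
  exists j, (#|A| <= #|I| * #|[set x in A | b x == j]|)%N.
Proof.
case/set0Pn => x _; have I0 : (0 < #|I|)%N by apply/card_gt0P; exists (b x).
have [j Ej] := bigop.eq_bigmax (fun j => #|[set x in A | b x == j]|) I0.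
exists j; rewrite -Ej -sum1_card (partition_big b xpredT) //= -sum_nat_const.
apply: leq_sum => i _; apply: leq_trans (leq_bigmax i).
by rewrite -sum1_card; apply/eq_leq/eq_bigl => y; rewrite inE.
Qed.

Lemma ln_le_harmonic_sum (m : nat) :
  ln (m.+1%:R : R) <= \sum_(0 <= i < m) i.+1%:R^-1.
Proof.
elim: m => [|m IH]; first by rewrite big_geq // ln1.
rewrite big_nat_recr //= -lerBlDl; apply: le_trans (lerB (lexx _) IH) _.
rewrite -ln_div ?posrE ?ltr0n //.
have -> : m.+2%:R / m.+1%:R = 1 + m.+1%:R^-1 :> R.
  by rewrite -(natr1 m.+1) mulrDl mulfV ?mul1r ?pnatr_eq0.
by apply: le_ln1Dx; rewrite (lt_trans (ltrN10 R)) ?invr_gt0 ?ltr0n.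
Qed.

Lemma ln_le_self (x : R) : 0 < x -> ln x <= x.
Proof.
move=> x0; have := @le_ln1Dx R (x - 1); rewrite (addrC 1) subrK ltrBrDr addNr.
by move=> /(_ x0) /le_trans; apply; rewrite gerBl.
Qed.

(** Both bounds are ln (1 + x) <= x, at x = -1/2 and x = 1. *)
Lemma ln2_itv : 1 / 2 <= ln (2 : R) <= 1.
Proof.
apply/andP; split; last by have := @le_ln1Dx R 1; apply; lra.
have := @le_ln1Dx R (- (1 / 2)).
have -> : 1 + - (1 / 2) = 2^-1 :> R by field.
rewrite lnV ?posrE // => H; have : - ln (2 : R) <= - (1 / 2) by apply: H; lra.
lra.
Qed.

Local Notation n := (#|V|%:R : R).

Lemma order_gt0 : 0 < n. Proof. by rewrite ltr0n (leq_trans _ V_gt1). Qed.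

(** Vertices of degree at most twice the average degree [vol / n]. *)
Definition low_deg : {set V} := [set v | d v * n <= 2 * vol].

(** Markov's inequality for the degree of a uniform vertex. *)
Lemma card_low_deg : n <= 2 * #|low_deg|%:R.
Proof.
have n0 := order_gt0; have v0 := vol_gt0.
have H : #|~: low_deg|%:R * (2 * vol) <= n * vol.
  rewrite mulr_natl -sumr_const [n * _]mulrC vol_deg mulr_suml.
  rewrite [leRHS](bigID (mem (~: low_deg))) /=.
  apply: (@le_trans _ _ (\sum_(v in ~: low_deg) d v * n)).
    by apply: ler_sum => v; rewrite !inE -ltNge -vol_deg => /ltW.
  by rewrite lerDl; apply: sumr_ge0 => v _; rewrite mulr_ge0 ?ler0n.
have : #|~: low_deg|%:R * 2 <= n by rewrite -(ler_pM2r v0) -mulrA.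
have : n = #|low_deg|%:R + #|~: low_deg|%:R by rewrite -natrD cardsC.
lra.
Qed.

Lemma commute_low_deg u v : v \in low_deg -> u != v -> n <= 2 * (hit u v + hit v u).
Proof.
rewrite inE => dv uv; have := commute_ge_vol_deg uv => H.
rewrite -(ler_pM2r (degR_gt0 v)) mulrC; apply: le_trans dv _.
by rewrite -mulrA ler_pM2l.
Qed.

(** * The n log n lower bound for the cover time *)

Section CoverLowerBound.
Variable c : R.
Hypothesis hit_le_c : forall u v, hit u v <= c.
Hypothesis matthews_le_c : forall (A : {set V}) (K : R), A != set0 ->
  (forall u v, u \in A -> v \in A -> u != v -> K <= hit u v) ->
  K * (\sum_(0 <= i < #|A|.-1) i.+1%:R^-1) <= c.

Lemma order_le_cover : n <= 4 * c.
Proof.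
have n0 := order_gt0.
have : (0 < #|low_deg|)%N.
  by rewrite -(ltr_nat R); have := card_low_deg; lra.
case/card_gt0P => v vL.
have [u uv] : exists u, u != v.
  have : (0 < #|predC1 v|)%N by rewrite cardC1 -subn1 subn_gt0.
  by move=> /card_gt0P[u uv]; exists u.
have := commute_low_deg vL uv; have := hit_le_c u v; have := hit_le_c v u; lra.
Qed.

(* Feige's dichotomy: either [kappa] spreads over an interval of length about
   [n ^ (3/2) / 4], and then some hitting time is that large, or about
   [sqrt n] low-degree vertices have [kappa] within [n / 4], and then hitting
   times between them are at least [n / 8] in both directions. *)
Lemma order_ln_le_cover : n * ln n <= 24 * c.
Proof.
have n0 := order_gt0; have nc := order_le_cover.
pose r := Num.sqrt n; have r0 : 0 < r by rewrite sqrtr_gt0.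
have rr : r * r = n by rewrite -expr2 sqr_sqrtr // ltW.
have r1 : 1 <= r by rewrite -sqrtr1 ler_wsqrtr // ler1n (leq_trans _ V_gt1).
have lnn : ln n = 2 * ln r by rewrite -rr lnM ?posrE //; ring.
pose J := Num.trunc r.
have /andP[Jr rJ] := truncn_itv (ltW r0); rewrite -/J in Jr rJ.
have J0 : (0 < J)%N by rewrite truncn_gt0.
have J1 : 1 <= J%:R :> R by rewrite ler1n.
have rJ2 : r <= 2 * J%:R by move: rJ; rewrite -natr1; lra.
(* In the first case ln n = 2 ln r <= 2 r <= 4 J already gives n ln n <= 16 c. *)
have [Jc|cJ] := leP (J%:R * (n / 4)) c.
  have H : ln n <= 4 * J%:R by have := ln_le_self r0; rewrite lnn; lra.
  have : n * ln n <= n * (4 * J%:R) by rewrite ler_wpM2l // ltW.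
  lra.
have /card_gt0P[x0 _] : (0 < #|V|)%N by apply: leq_trans V_gt1.
have [z _ zmin] := arg_minP kappa (isT : xpredT x0).
(* The height of [kappa] above its minimum in units of n/4. As kappa(v) - kappa(z) <= H(z,v) <= c <
   J n/4, its integer part takes fewer than J + 1 values, and [J] classes suffice. *)
pose h v := (kappa v - kappa z) / (n / 4).
have w0 : 0 < n / 4 by rewrite divr_gt0.
have h0 v : 0 <= h v by rewrite divr_ge0 ?subr_ge0 ?zmin // ltW.
have hJ v : (Num.trunc (h v) < J)%N.
  rewrite truncn_lt_nat // ltr_pdivrMr //; apply: le_lt_trans cJ.
  rewrite -hit_asym; have := hit_le_c z v; have := hit_ge0 v z; lra.
have L0 : low_deg != set0.
  by rewrite -card_gt0 -(ltr_nat R); have := card_low_deg; lra.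
have [j] := pigeonhole (fun v => Ordinal (hJ v)) L0.
rewrite card_ord; set A := [set x in _ | _] => AJ.
have AJR : n <= 2 * (J%:R * #|A|%:R).
  apply: le_trans card_low_deg _; rewrite ler_pM2l // -natrM ler_nat //.
have A0 : (0 < #|A|)%N.
  by case: (posnP #|A|) => // A0; move: AJR; rewrite A0; lra.
(* The sum H(u,v) + H(v,u) is at least n/2, while H(v,u) - H(u,v) is at most n/4. *)
have HK u v : u \in A -> v \in A -> u != v -> n / 8 <= hit u v.
  rewrite !inE => /andP[_ /eqP uj] /andP[vL /eqP vj] uv.
  have tE : Num.trunc (h u) = Num.trunc (h v).
    by move/(congr1 val): uj; move/(congr1 val): vj => /= -> ->.
  have /andP[u1 u2] := truncn_itv (h0 u); have /andP[v1 v2] := truncn_itv (h0 v).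
  have : h u - h v <= 1 by move: u2 v1; rewrite tE -natr1; lra.
  rewrite /h -mulrBl ler_pdivrMr // mul1r opprB addrA subrK -hit_asym => H.
  have : n <= 2 * (hit u v + hit v u) by apply: commute_low_deg; rewrite // inE.
  lra.
have := matthews_le_c _ HK; rewrite -card_gt0 => /(_ A0).
have := ln_le_harmonic_sum #|A|.-1; rewrite prednK // => lnA.
have rA : r / 2 <= #|A|%:R.
  rewrite ler_pdivrMr // -(ler_pM2l r0) rr; apply: le_trans AJR _.
  have : J%:R * #|A|%:R <= r * #|A|%:R :> R by rewrite ler_wpM2r.
  lra.
have lnA2 : ln r - ln 2 <= ln #|A|%:R.
  by rewrite -ln_div ?posrE // ler_ln ?posrE ?divr_gt0 ?ltr0n.
have := andP ln2_itv => -[_ ln21] Hc.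
(* With n <= 4 c this yields n ln n = 2 n ln r <= 16 c + 2 n <= 24 c. *)
have : n / 8 * (ln r - 1) <= n / 8 * \sum_(0 <= i < #|A|.-1) i.+1%:R^-1.
  by apply: ler_wpM2l; [rewrite divr_ge0 // ltW | lra].
rewrite lnn; lra.
Qed.

End CoverLowerBound.

Lemma cov_rba_ratio_lower :
  170^-1 * (Num.sqrt n / Delta) * Num.sqrt (ln n) <= cov_rba_ratio R e.
Proof.
have n0 := order_gt0; have De0 := max_deg_gt0.
rewrite /cov_rba_ratio /COV /RBA.
have [z [-> cov_max]] : exists z, \big[maxe/-oo%E]_s COVs R e s = COVs R e z /\
    forall s, fine (COVs R e s) <= fine (COVs R e z).
  by apply: bigmaxe_real => s; have [r [Er _]] := COVs_bounds s; exists r.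
set c := fine (COVs R e z) in cov_max *.
have hit_le_c u v : hit u v <= c := le_trans (hit_le_COVs u v) (cov_max u).
have matthews_le_c (A : {set V}) (K : R) : A != set0 ->
    (forall u v, u \in A -> v \in A -> u != v -> K <= hit u v) ->
    K * (\sum_(0 <= i < #|A|.-1) i.+1%:R^-1) <= c.
  by move=> /set0Pn[s sA] HK; apply: le_trans (matthews_le_COVs sA HK) (cov_max s).
have nL := order_ln_le_cover hit_le_c matthews_le_c.
have V2 : (0 < #|{: V * V}|)%N.
  by rewrite card_prod muln_gt0 !(leq_trans _ V_gt1).
have [[u v] DE] := bigop.eq_bigmax (fun p : V * V => gdist [set p.1] p.2) V2.
set D := \max_p _ in DE.
have D_max s w : (gdist [set s] w <= D)%N.
  exact: (leq_bigmax (F := fun p : V * V => gdist [set p.1] p.2) (s, w)).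
(* The distance from [u] is 1-Lipschitz, so the diametral pair has commute time at least 2 D^2, and
   each hitting time is at most [c]. *)
have D2 : D%:R ^+ 2 <= c.
  have u0 : [set u] != set0 by apply/set0Pn; exists u; rewrite set11.
  have := commute_ge_lipschitz u v (fun x y => @gdist_lipschitz [set u] x y u0).
  have -> : gdist [set u] u = 0%N by apply/eqP; rewrite gdist_eq0 ?set11.
  rewrite -[gdist _ v]/(gdist [set (u, v).1] (u, v).2) -DE sub0r sqrrN.
  by have := hit_le_c u v; have := hit_le_c v u; lra.
have [z' [-> _]] : exists z', \big[maxe/-oo%E]_s RBAs R e s = RBAs R e z' /\
    forall s, fine (RBAs R e s) <= fine (RBAs R e z').
  by apply: bigmaxe_real => s; have [r [Er _ _]] := RBAs_bounds (D_max s); exists r.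
have [b [-> b1 b_le]] := RBAs_bounds (D_max z'); rewrite /=.
pose q := Num.sqrt n * Num.sqrt (ln n).
have n2 : 2 <= n by rewrite ler_nat.
have L2 : 1 / 2 <= ln n.
  have /andP[l2 _] := ln2_itv; apply: le_trans l2 _.
  by rewrite ler_ln ?posrE.
have qq : q ^+ 2 = n * ln n by rewrite exprMn !sqr_sqrtr //; lra.
have q0 : 0 <= q by rewrite mulr_ge0 ?sqrtr_ge0.
have Lq : ln n <= q.
  rewrite -(@ler_pXn2r _ 2) ?nnegrE ?qq //; last lra.
  by rewrite expr2 ler_wpM2r ?ln_le_self //; lra.
have b0 : 0 < b by apply: lt_le_trans b1.
rewrite ler_pdivlMr //.
have -> : 170^-1 * (Num.sqrt n / Delta) * Num.sqrt (ln n) * b = q * b / (170 * Delta).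
  by rewrite /q; field; rewrite gt_eqF.
rewrite ler_pdivrMr ?mulr_gt0 //.
have : q * b <= q * (2 * Delta * (1 + (ln n + D%:R))) by rewrite ler_wpM2l.
move=> /le_trans; apply.
(* Here q <= 2 q ln n, q ln n <= q^2 and 2 q D <= q^2 + D^2, so the left side is at most 7/2 q^2 +
   D^2/2 <= 84 c + c/2. The factor 2 Delta of the broadcast bound turns 85 into 170. *)
have H : q * (1 + (ln n + D%:R)) <= 85 * c.
  have h1 : q * ln n <= q ^+ 2 by rewrite expr2 ler_wpM2l.
  have h2 : 0 <= (q - D%:R) ^+ 2 by exact: sqr_ge0.
  have h3 : q * 1 <= q * (2 * ln n) by rewrite ler_wpM2l //; lra.
  have : (q - D%:R) ^+ 2 = q ^+ 2 - 2 * (q * D%:R) + D%:R ^+ 2 by ring.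
  rewrite !mulrDr; lra.
have -> : q * (2 * Delta * (1 + (ln n + D%:R))) = q * (1 + (ln n + D%:R)) * (2 * Delta) by ring.
have -> : c * (170 * Delta) = 85 * c * (2 * Delta) by ring.
by rewrite ler_wpM2r // mulr_ge0 // ltW.
Qed.

End Walk.

Theorem proposition4p4 (R : realType) :
  exists C : R, 0 < C /\
    forall (V : finType) (e : rel V),
      symmetric e -> irreflexive e ->
      (forall x y : V, connect e x y) ->
      (2 <= #|V|)%N ->
      C * (Num.sqrt (#|V|%:R) / (max_deg e)%:R) * Num.sqrt (ln (#|V|%:R))
        <= cov_rba_ratio R e.
Proof.
exists 170^-1; split=> [|V e e_sym e_irr e_conn V_gt1]; first by rewrite invr_gt0.
exact: cov_rba_ratio_lower.
Qed.
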